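(* Let $\mathscr{F}=\{[0),[1)\}$. Then the semigroup $\boldsymbol{End}^*(\boldsymbol{B}_{\omega}^{\mathscr{F}})$ of all non-injective non-annihilating monoid endomorphisms of $\boldsymbol{B}_{\omega}^{\mathscr{F}}$ is isomorphic to the direct product $\mathfrak{LZ}_2\times\mathbb{N}_u$, where $\mathfrak{LZ}_2$ is the left zero semigroup with two elements and $\mathbb{N}_u$ is the multiplicative semigroup of positive integers.
   Context: $\omega$ is the set of non-negative integers; for $a\in\omega$, $[a)=\{x\in\omega: x\geqslant a\}$; for $n\in\mathbb{Z}$ and $F\subseteq\omega$, $n+F=\{n+k: k\in F\}$. For $\mathscr{F}=\{[0),[1)\}$, $\boldsymbol{B}_{\omega}^{\mathscr{F}}$ is the set $\omega\times\omega\times\mathscr{F}$ with the operation $$(i_1,j_1,F_1)\cdot(i_2,j_2,F_2)=\begin{cases}(i_1-j_1+i_2,\,j_2,\,(j_1-i_2+F_1)\cap F_2), & j_1\leqslant i_2;\\ (i_1,\,j_1-i_2+j_2,\,F_1\cap(i_2-j_1+F_2)), & j_1\geqslant i_2.\end{cases}$$ This is an (inverse) monoid with identity $(0,0,[0))$. A monoid endomorphism is a semigroup endomorphism fixing the identity. The annihilating monoid endomorphism is the constant map sending every element to $(0,0,[0))$. $\boldsymbol{End}^*(\boldsymbol{B}_{\omega}^{\mathscr{F}})$ is the set of all monoid endomorphisms of $\boldsymbol{B}_{\omega}^{\mathscr{F}}$ that are not injective and are different from the annihilating one; it is a semigroup under composition, where maps are written on the right and composed from left to right: $(x)(fg)=((x)f)g$.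 A left zero semigroup is a semigroup in which $xy=x$ for all $x,y$. *)

(* Defs.v *)
From HB Require Import structures.
From mathcomp Require Import all_boot ssralg ssrint.
From mathcomp Require Import zify.
From mathcomp Require Import boolp classical_sets.

Set Implicit Arguments.
Unset Strict Implicit.
Unset Printing Implicit Defensive.

Local Open Scope classical_set_scope.

Definition ray (a : nat) : set nat := [set x | a <= x].

(* For n : int, [shift n F] is (n + F) `&` omega: the negative elements of
   n + F are dropped, which is harmless as n + F is only ever intersected with
   a subset of omega. *)
Definition shift (n : int) (F : set nat) : set nat :=
  [set x | exists2 k, F k & (x%:Z = n + k%:Z)%R].

Lemma shiftE (a b : nat) (F : set nat) (x : nat) : a <= b ->
  shift (a%:Z - b%:Z)%R F x = F (x + (b - a)).
Proof.
move=> leab; apply/propext; split=> [[k Fk xE]|Fx].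
  by have -> : x + (b - a) = k by lia.
by exists (x + (b - a)) => //; lia.
Qed.

(* B_omega^{P(omega)}, of which every B_omega^F with F an omega-closed family
   is a subsemigroup. *)
Definition BwP : Type := (nat * nat * set nat)%type.

HB.instance Definition _ := Choice.on BwP.

(* The truncated subtractions below are exact: in the first branch
   i1 + (i2 - j1) is i1 - j1 + i2, as j1 <= i2, and in the second one
   (j1 - i2) + j2 has i2 <= j1; the two branches agree when j1 = i2. *)
Definition Bmul (u v : BwP) : BwP :=
  let: (i1, j1, F1) := u in
  let: (i2, j2, F2) := v in
  if j1 <= i2
  then (i1 + (i2 - j1), j2, shift (j1%:Z - i2%:Z)%R F1 `&` F2)
  else (i1, (j1 - i2) + j2, F1 `&` shift (i2%:Z - j1%:Z)%R F2).

Definition Bone : BwP := (0, 0, ray 0).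

Lemma BmulE i1 j1 F1 i2 j2 F2 : Bmul (i1, j1, F1) (i2, j2, F2) =
  (i1 + (i2 - j1), (j1 - i2) + j2,
   [set x | F1 (x + (i2 - j1)) /\ F2 (x + (j1 - i2))]).
Proof.
rewrite /Bmul; case: leqP => h; congr (_, _, _); try lia.
- apply/funext => x; rewrite /setI/= shiftE //.
  by have -> : x + (j1 - i2) = x by lia.
- apply/funext => x; rewrite /setI/= shiftE; last exact: ltnW.
  by have -> : x + (i2 - j1) = x by lia.
Qed.

Lemma BmulA : associative Bmul.
Proof.
move=> [[i1 j1] F1] [[i2 j2] F2] [[i3 j3] F3]; rewrite !BmulE.
congr (_, _, _); try lia.
apply/funext => x; apply/propext; rewrite /mkset.
set a1 := x + _; set a2 := _ + (i3 - j2); set a3 := _ + (j2 - i3).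
set b1 := _ + (i2 - j1); set b2 := _ + (j1 - i2); set b3 := x + _.
have -> : a1 = b1 by rewrite /a1 /b1; lia.
have -> : a2 = b2 by rewrite /a2 /b2; lia.
have -> : a3 = b3 by rewrite /a3 /b3; lia.
by tauto.
Qed.

Lemma Bmul1 : left_id Bone Bmul.
Proof.
move=> [[i j] F]; rewrite BmulE; congr (_, _, _); try lia.
by apply/funext => x; apply/propext; rewrite /mkset addn0; split=> [[]|].
Qed.

Lemma B1mul : right_id Bone Bmul.
Proof.
move=> [[i j] F]; rewrite BmulE; congr (_, _, _); try lia.
by apply/funext => x; apply/propext; rewrite /mkset addn0; split=> [[]|].
Qed.

HB.instance Definition _ := isMonoid.Build BwP BmulA Bmul1 B1mul.

Definition F01 : set (set nat) := [set ray 0; ray 1].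

Lemma F01P (F : set nat) : F01 F <-> exists2 a, a <= 1 & F = ray a.
Proof.
split=> [[->|->]|[[|[|//]] _ ->]]; [by exists 0|by exists 1|by left|by right].
Qed.

Lemma Bmul_rayE i1 j1 a1 i2 j2 a2 :
  Bmul (i1, j1, ray a1) (i2, j2, ray a2) =
  (i1 + (i2 - j1), (j1 - i2) + j2,
   ray (maxn (a1 - (i2 - j1)) (a2 - (j1 - i2)))).
Proof.
by rewrite BmulE; congr (_, _, _); apply/funext => x; apply/propext;
  rewrite /ray /mkset; lia.
Qed.

Definition BwF_set : set BwP := [set: nat] `*` [set: nat] `*` F01.

Lemma BwF_setP (u : BwP) :
  BwF_set u <-> exists i j a, a <= 1 /\ u = (i, j, ray a).
Proof.
case: u => [[i j] F]; split=> [[_ /= /F01P[a a1 ->]]|[i' [j' [a [a1 [-> -> ->]]]]]].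
  by exists i, j, a.
by split=> //=; apply/F01P; exists a.
Qed.

Fact BwF_closed : monoid_closed (mem BwF_set).
Proof.
split; first by apply/mem_set/BwF_setP; exists 0, 0, 0.
move=> u v /set_mem/BwF_setP[i1 [j1 [a1 [h1 ->]]]].
move=> /set_mem/BwF_setP[i2 [j2 [a2 [h2 ->]]]].
by apply/mem_set/BwF_setP; rewrite [(_ * _)%g]Bmul_rayE; do 3!eexists; split; last by []; lia.
Qed.

Definition BwF : Type := set_type BwF_set.

HB.instance Definition _ := SubChoice.on BwF.
HB.instance Definition _ :=
  SubChoice_isSubMonoid.Build BwP (mem BwF_set) BwF BwF_closed.

Section Transformations.
Variable T : choiceType.

Definition transf : Type := T -> T.

HB.instance Definition _ := Choice.on transf.

(* Maps act on the right: the product f g is "first f, then g". *)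
Definition transf_mul (f g : transf) : transf := g \o f.

Fact transf_mulA : associative transf_mul.
Proof. by []. Qed.

HB.instance Definition _ := isSemigroup.Build transf transf_mulA.

End Transformations.

Definition annihilating : transf BwF := fun=> 1%g.

Definition EndStar_set : set (transf BwF) :=
  [set f | [/\ monoid_morphism (f : BwF -> BwF), ~ injective f
             & f <> annihilating]].

(* The remaining facts before [EndStar] show that [EndStar_set] is closed under
   products: the monoid BwF is generated by p = (0, 1, [0)), q = (1, 0, [0))
   and e = (0, 0, [1)), where p q = 1 and p e = p, so that a monoid
   endomorphism sending p to 1 is annihilating. *)
Fact Bin_subproof i j (b : bool) : (i, j, ray b) \in BwF_set.
Proof. by apply/mem_set/BwF_setP; exists i, j, b; split=> //; case: b. Qed.

Definition Bin i j (b : bool) : BwF := 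
  exist [in BwF_set] _ (Bin_subproof i j b).

Lemma BinP (u : BwF) : exists i j b, u = Bin i j b.
Proof.
case: u => u uP; have /set_mem/BwF_setP[i [j [a [a1 uE]]]] := uP.
exists i, j, (a == 1); apply/val_inj => /=; rewrite uE.
by case: a a1 {uE} => [|[|]].
Qed.

Lemma val_Bin i j b : val (Bin i j b) = (i, j, ray b).
Proof. by []. Qed.

Lemma ray_inj : injective ray.
Proof.
move=> a b ab; have : ray a a by apply: leqnn.
have : ray b b by apply: leqnn.
by rewrite -{1}ab {2}ab /ray /mkset; lia.
Qed.

Lemma Bin_inj i j b i' j' b' :
  Bin i j b = Bin i' j' b' -> [/\ i = i', j = j' & b = b'].
Proof.
by move=> /(congr1 val); rewrite !val_Bin => -[-> -> /ray_inj]; case: b b' => [] [].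
Qed.

Lemma BinM i1 j1 (b1 : bool) i2 j2 (b2 : bool) :
  (Bin i1 j1 b1 * Bin i2 j2 b2)%g =
  Bin (i1 + (i2 - j1)) ((j1 - i2) + j2)
      (0 < maxn (b1 - (i2 - j1)) (b2 - (j1 - i2))).
Proof.
apply/val_inj; rewrite valM !val_Bin [LHS]Bmul_rayE; congr (_, _, ray _).
by case: b1 b2 => [] []; lia.
Qed.

Lemma Bin1 : 1%g = Bin 0 0 false.
Proof. by apply/val_inj; rewrite val1. Qed.

Lemma Bin_expl n : (Bin 0 1 false ^+ n)%g = Bin 0 n false.
Proof.
elim: n => [|n IHn]; first by rewrite expg0 Bin1.
by rewrite expgS IHn BinM /=; congr (Bin _ _ _); lia.
Qed.

Lemma Bin_expr n : (Bin 1 0 false ^+ n)%g = Bin n 0 false.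
Proof.
elim: n => [|n IHn]; first by rewrite expg0 Bin1.
by rewrite expgSr IHn BinM /=; congr (Bin _ _ _); lia.
Qed.

Lemma annihilatingP (f : transf BwF) : monoid_morphism (f : BwF -> BwF) ->
  f (Bin 0 1 false) = 1%g -> f = annihilating.
Proof.
case=> f1 fM fp; apply/funext => u.
have fX x n : f (x ^+ n)%g = (f x ^+ n)%g.
  by elim: n => [|n IHn]; rewrite ?expg0 ?expgS ?fM ?IHn.
have fq : f (Bin 1 0 false) = 1%g.
  by have := fM (Bin 0 1 false) (Bin 1 0 false); rewrite BinM -[X in f X]Bin1 f1 fp mul1g.
have fe : f (Bin 0 0 true) = 1%g.
  by have := fM (Bin 0 1 false) (Bin 0 0 true); rewrite BinM fp mul1g.
have [i [j [b ->]]] := BinP u.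
have -> : Bin i j b =
    (Bin 1 0 false ^+ i * Bin 0 0 b * Bin 0 1 false ^+ j)%g.
  by rewrite Bin_expl Bin_expr !BinM; case: b; congr (Bin _ _ _); lia.
rewrite !fM !fX fp fq !expg1n mul1g mulg1 /annihilating.
by case: b; rewrite ?fe // -Bin1.
Qed.

Lemma right_unit (u v : BwF) : (u * v = 1)%g ->
  exists n, u = (Bin 0 1 false ^+ n)%g.
Proof.
have [i [j [b ->]]] := BinP u; have [k [l [c ->]]] := BinP v.
rewrite BinM Bin1 => /Bin_inj[ijk jkl /negbT bc].
by exists j; rewrite Bin_expl; congr (Bin _ _ _); [lia|case: b bc; lia].
Qed.

Fact EndStar_closed : mulg_closed (mem EndStar_set).
Proof.
move=> f g /set_mem[fH finj fn] /set_mem[gH ginj gn]; apply/mem_set.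
have [f1 fM] := fH; have [g1 gM] := gH.
have fgE x : (f * g)%g x = g (f x) by [].
split.
- by split=> [|x y]; rewrite !fgE ?f1 ?g1 ?fM ?gM.
- by move=> fginj; apply: finj => x y fxy; apply: fginj; rewrite !fgE fxy.
move=> fgn; have gfp : g (f (Bin 0 1 false)) = 1%g by rewrite -fgE fgn.
have [|n fpE] := @right_unit (f (Bin 0 1 false)) (f (Bin 1 0 false)).
  by rewrite -fM BinM /= -Bin1.
case: n fpE => [|n] fpE; first by apply/fn/annihilatingP; rewrite ?fpE ?expg0.
apply/gn/annihilatingP => //; move: gfp; rewrite fpE expgS gM.
case/right_unit => m gpE.
have gX x k : g (x ^+ k)%g = (g x ^+ k)%g.
  by elim: k => [|k IHk]; rewrite ?expg0 ?expgS ?gM ?IHk.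
have : g (f (Bin 0 1 false)) = 1%g by rewrite -fgE fgn.
rewrite fpE gX gpE -expgnA !Bin_expl Bin1 => /Bin_inj[_ mn _].
by have -> : m = 0 by lia.
Qed.

Definition EndStar : Type := set_type EndStar_set.

HB.instance Definition _ := SubChoice.on EndStar.
HB.instance Definition _ := SubChoice_isSubSemigroup.Build
  (transf BwF) (mem EndStar_set) EndStar EndStar_closed.

Definition LZ2 : Type := bool.

HB.instance Definition _ := Choice.on LZ2.

Definition LZ2_mul (x y : LZ2) : LZ2 := x.

Fact LZ2_mulA : associative LZ2_mul.
Proof. by []. Qed.

HB.instance Definition _ := isSemigroup.Build LZ2 LZ2_mulA.

Definition Nu : Type := {n : nat | 0 < n}.

HB.instance Definition _ := SubChoice.on Nu.

Fact Nu_mul_subproof (m n : Nu) : 0 < val m * val n.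
Proof. by rewrite muln_gt0 (valP m) (valP n). Qed.

Definition Nu_mul (m n : Nu) : Nu := exist (leq 1) _ (Nu_mul_subproof m n).

Fact Nu_mulA : associative Nu_mul.
Proof. by move=> x y z; apply/val_inj; rewrite /= mulnA. Qed.

HB.instance Definition _ := isSemigroup.Build Nu Nu_mulA.

Definition isomorphic (G H : semigroupType) : Prop :=
  exists f : {multiplicative G -> H}, bijective f.

(* Main.v *)
Require Import Defs.
From mathcomp Require Import all_boot.
From HB Require Import structures.
From mathcomp Require Import zify.
From mathcomp Require Import boolp classical_sets.

Set Implicit Arguments.
Unset Strict Implicit.
Unset Printing Implicit Defensive.

(** The monoid is generated by p = (0, 1, [0)), q = (1, 0, [0)) and
    e = (0, 0, [1)), with (i, j, [b)) = q^i e^b p^j.  A non-annihilating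
    endomorphism f sends p to p^k and q to q^k for some k > 0, and since
    p e = p it sends e to an idempotent (s, s, [c)) absorbed by p^k, so that
    s <= k, and c = 0 when s = k.  Then f sends q^i e p^j to
    (k i + s, k j + s, [c)), which is distinct from every q^(k i') p^(k j')
    unless c = 0 and s is 0 or k.  The two cases s = 0 and s = k are the two
    elements of the left zero factor, and k is the positive integer; as the
    image then consists of triples with last component [0), the choice of s in
    the second factor of a product is irrelevant. *)

(* For u = (i, j, ray b), the boolean [~~ `[< (val u).2 0 >]] recovers b. *)
Definition endo (t : bool) (k : nat) : transf BwF := fun u =>
  let s := t && ~~ `[< (val u).2 0 >] in
  Bin (k * ((val u).1.1 + s)) (k * ((val u).1.2 + s)) false.

Lemma endoE t k i j b :
  endo t k (Bin i j b) = Bin (k * (i + (t && b))) (k * (j + (t && b))) false.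
Proof.
rewrite /endo val_Bin /=.
suff -> : `[< ray b 0 >] = ~~ b by rewrite negbK.
by apply/asboolP/idP; rewrite /ray /mkset; case: b.
Qed.

Lemma endo_monoid_morphism t k : monoid_morphism (endo t k : BwF -> BwF).
Proof.
split=> [|u v]; first by rewrite Bin1 endoE andbF muln0.
have [i1 [j1 [b1 ->]]] := BinP u; have [i2 [j2 [b2 ->]]] := BinP v.
rewrite BinM !endoE BinM -!mulnBr -!mulnDr /=.
by congr (Bin (k * _) (k * _) _); case: t b1 b2 => [] [] []; lia.
Qed.

Lemma endo_EndStar t k : 0 < k -> EndStar_set (endo t k).
Proof.
move=> k0; split; first exact: endo_monoid_morphism.
(* The elements (0, 0, [1)) and (t, t, [0)) share the image (k t, k t, [0)). *)
- move=> /(_ (Bin 0 0 true) (Bin t t false)).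
  rewrite !endoE andbF andbT add0n addn0 => /(_ erefl).
  by case/Bin_inj.
- move=> /(congr1 (fun f : transf BwF => f (Bin 0 1 false))).
  by rewrite endoE /annihilating Bin1 => /Bin_inj[_]; lia.
Qed.

(** The image of q determines k and, as k > 0, the image of e then determines t. *)
Lemma endo_inj t k t' k' : 0 < k -> endo t k = endo t' k' -> t = t' /\ k = k'.
Proof.
move=> k0 fE.
have := congr1 (fun f : transf BwF => f (Bin 0 0 true)) fE.
have := congr1 (fun f : transf BwF => f (Bin 1 0 false)) fE.
rewrite !endoE !andbF !andbT => /Bin_inj[kk' _ _] /Bin_inj[tt' _ _].
have {kk'} ek : k = k' by lia.
by split=> //; move: tt'; rewrite -ek; case: t t' {fE} => [] []; lia.
Qed.

Lemma endo_mul t k t' k' :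
  (endo t k * endo t' k')%g = endo t (k * k').
Proof.
apply/funext => u; have [i [j [b ->]]] := BinP u.
transitivity (endo t' k' (endo t k (Bin i j b))) => //.
rewrite !endoE andbF !addn0.
by rewrite !mulnA (mulnC k').
Qed.

Lemma EndStarP (f : transf BwF) : EndStar_set f ->
  exists t k, 0 < k /\ f = endo t k.
Proof.
case=> fH finj fn; have [f1 fM] := fH.
have fX x n : f (x ^+ n)%g = (f x ^+ n)%g.
  by elim: n => [|n IHn]; rewrite ?expg0 ?expgS ?fM ?IHn.
have fpq : (f (Bin 0 1 false) * f (Bin 1 0 false) = 1)%g.
  by rewrite -fM BinM /= -Bin1.
have [k fp] := right_unit fpq; rewrite Bin_expl in fp.
have k0 : 0 < k.
  case: k fp => // fp; case: fn; apply: annihilatingP => //.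
  by rewrite fp -Bin1.
have fq : f (Bin 1 0 false) = Bin k 0 false.
  (* The only right inverse of p^k is q^k. *)
  move: fpq; rewrite fp; have [i [l [c ->]]] := BinP (f (Bin 1 0 false)).
  rewrite BinM Bin1 => /Bin_inj[ik kl /negbT bc].
  by congr Bin; [lia|lia|case: c bc; lia].
have fp_n n : f (Bin 0 n false) = Bin 0 (k * n) false.
  by rewrite -(Bin_expl n) fX fp -(Bin_expl k) -(Bin_expl (k * n)) expgnA.
have fq_n n : f (Bin n 0 false) = Bin (k * n) 0 false.
  by rewrite -(Bin_expr n) fX fq -(Bin_expr k) -(Bin_expr (k * n)) expgnA.
have [s [c [fe sk ck]]] : exists s c,
    [/\ f (Bin 0 0 true) = Bin s s c, s <= k & c -> s < k].
  have := fM (Bin 0 0 true) (Bin 0 0 true).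
  have := fM (Bin 0 1 false) (Bin 0 0 true).
  rewrite !BinM /= fp; have [i [j [c ->]]] := BinP (f (Bin 0 0 true)).
  rewrite !BinM => /Bin_inj[ik kj kc] /Bin_inj[ii jj _].
  exists i, c; split; [congr Bin; lia|lia|by case: c kc; lia].
have fE i j b : f (Bin i j b) =
    Bin (k * i + b * s) (k * j + b * s) (b && c).
  have -> : Bin i j b = (Bin i 0 false * Bin 0 0 b * Bin 0 j false)%g.
    by rewrite !BinM; case: b; congr (Bin _ _ _); lia.
  rewrite !fM fp_n fq_n; case: b; last first.
    by rewrite -Bin1 f1 mulg1 BinM; congr Bin; lia.
  by rewrite fe !BinM; case: c {fe ck}; congr Bin; lia.
(* The exceptional values s = 0 and s = k are k t for the two booleans t. *)
have fdet (t : bool) : f (Bin 0 0 true) = Bin (k * t) (k * t) false ->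
    exists t k, 0 < k /\ f = endo t k.
  rewrite fe => /Bin_inj[sE _ cE]; exists t, k; split=> //.
  apply/funext => u; have [i [j [b ->]]] := BinP u.
  rewrite fE endoE sE cE andbF.
  by case: b; rewrite ?andbT ?andbF; congr Bin; lia.
have [[c0 [s0|sk']]|gen] := pselect (c = false /\ (s = 0 \/ s = k)).
- by apply: (fdet false); rewrite fe c0 s0 muln0.
- by apply: (fdet true); rewrite fe c0 sk' muln1.
case: finj => u v; have [i [j [b ->]]] := BinP u.
have [i' [j' [b' ->]]] := BinP v.
(* Here k divides s, and [sk] leaves only two multiples. *)
have smod x y : k * x + s = k * y -> s = 0 \/ s = k.
  by move=> xy; have [//|] := leqP y x; [left|right]; nia.
(* If b = b', cancelling s and k > 0 gives u = v; otherwise equal images force c = false and k to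
   divide s, against [gen]. *)
rewrite !fE; case: b b' => [] [] /Bin_inj[]; rewrite ?mul1n ?mul0n ?addn0 /=.
- by move=> ii jj _; congr Bin; nia.
- by move=> ii _ cE; case: gen; split=> //; apply: smod ii.
- by move=> ii _ cE; case: gen; split=> //; apply: smod (esym ii).
- by move=> ii jj _; congr Bin; nia.
Qed.

Theorem proposition2 : isomorphic EndStar (LZ2 * Nu)%type.
Proof.
have endo_in (x : LZ2 * Nu) : endo x.1 (val x.2) \in EndStar_set.
  by apply/mem_set/endo_EndStar/(valP x.2).
pose g (x : LZ2 * Nu) : EndStar := exist [in EndStar_set] _ (endo_in x).
have ginj : injective g.
  move=> [t k] [t' k'] /(congr1 val) /= /endo_inj[|/= -> kk'].
    exact: (valP k).
  by congr (_, _); apply/val_inj.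
have gsurj (f : EndStar) : exists x, g x = f.
  have /set_mem/EndStarP[t [k [k0 fE]]] := valP f.
  by exists (t, exist _ k k0); apply/val_inj; rewrite fE.
(* The isomorphism is the inverse of [g]; its multiplicativity follows from [endo_mul] by
   injectivity of [g]. *)
have [h hK] := choice gsurj.
have hM : {morph h : x y / (x * y)%g}.
  move=> x y; apply: ginj; rewrite hK -{1}(hK x) -{1}(hK y).
  by apply/val_inj; rewrite valM /= endo_mul.
pose hm := isMultiplicative.Build EndStar (LZ2 * Nu)%type h hM.
pose H : {multiplicative EndStar -> LZ2 * Nu} := HB.pack h hm.
by exists H; exists g => // x; apply: ginj; rewrite hK.
Qed.
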